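(* Let $p$ be a prime and identify $\mathbb{Z}/p\mathbb{Z}$ with $\{0,1,\dots,p-1\}$. Let $A,B\subseteq\mathbb{Z}/p\mathbb{Z}$ with $|A|,|B|\ge 2$, $p\ge |A|+|B|-2$, and $\max A+\max B<p$ (as integers). Then $|A\widehat{+}B|=|A|+|B|-3$ if and only if $A=B$ and one of the following holds: (1) $|A|=2$ or $|A|=3$; (2) $|A|=4$ and $A=\{a,a+d,c,c+d\}$ for some $a,c,d$; (3) $|A|\ge 5$ and $A$ is an arithmetic progression.
   Context: For $A,B\subseteq\mathbb{Z}/p\mathbb{Z}$, the restricted sumset is $A\widehat{+}B=\{a+b \bmod p: a\in A,\ b\in B,\ a\neq b\}$. *)

(* Defs.v *)
From mathcomp Require Import all_boot all_order all_algebra.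
Set Implicit Arguments.
Unset Strict Implicit.
Unset Printing Implicit Defensive.
Import GRing.Theory.
Local Open Scope ring_scope.

Definition restricted_sumset (p : nat) (A B : {set 'F_p}) : {set 'F_p} :=
  [set a + b | a in A, b in B & a != b].

(* Largest element of a nonempty set of residues, each residue being read as
   its representative in {0, ..., p - 1} (the value is 0 on the empty set). *)
Definition max_repr (p : nat) (A : {set 'F_p}) : nat :=
  \max_(a in A) (a : nat).

(* Progressions are taken in Z/pZ, so they may wrap around. *)
Definition is_arith_prog (p : nat) (A : {set 'F_p}) : Prop :=
  exists (a d : 'F_p) (n : nat), A = [set a + d *+ i | i : 'I_n].

(* Main.v *)
(** Since max A + max B < p, sums of representatives never wrap around, so
    everything happens for sets of natural numbers.  With a = min A and
    M = max B, the strictly increasing chain a + B, A + M contains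
    |A| + |B| - 1 sums, of which only 2a and 2M may fail to be restricted sums.
    If the bound |A| + |B| - 3 is attained, both are lost, for (A, B) and for
    (B, A), so A and B have the same extremes; then x in A \ B would give the
    extra sum x + a, whence A = B.  Moreover every restricted sum of A lies on
    the chain: writing a < b for the two smallest and N < M for the two largest
    elements, comparing b + x and N + x with the chain shows that A is stable
    under translation by b - a = M - N away from its ends. *)
Require Import Defs.
From mathcomp Require Import all_boot all_order all_algebra.
From mathcomp Require Import zify ring.
Set Implicit Arguments.
Unset Strict Implicit.
Unset Printing Implicit Defensive.
Import GRing.Theory.
Local Open Scope ring_scope.

(** * Restricted sums of finite sets of natural numbers *)

Section NatSeq.
Local Open Scope nat_scope.
Implicit Types (A B S s t : seq nat).

Lemma uniq_has_notin s t :
  uniq s -> size t < size s -> exists x, (x \in s) && (x \notin t).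
Proof.
move=> Us lt_ts; have /hasP[x xs xt] : has (fun x => x \notin t) s.
  rewrite has_predC; apply: contraL lt_ts => /allP st.
  by rewrite -leqNgt uniq_leq_size.
by exists x; rewrite xs.
Qed.

(** With [t] empty this gives the minimum; with [t] holding the minimum, the second smallest
    element, and so on. *)
Lemma uniq_min_notin s t : uniq s -> size t < size s ->
  exists m, [/\ m \in s, m \notin t & {in s, forall x, x \notin t -> m <= x}].
Proof.
move=> Us lt_ts; case: (ex_minnP (uniq_has_notin Us lt_ts)) => m /andP[ms mt] minm.
by exists m; split=> // x xs xt; apply: minm; rewrite xs.
Qed.

Lemma uniq_max_notin s t : uniq s -> size t < size s ->
  exists m, [/\ m \in s, m \notin t & {in s, forall x, x \notin t -> x <= m}].
Proof.
move=> Us lt_ts.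
have ub x : (x \in s) && (x \notin t) -> x <= \max_(y <- s) y.
  by case/andP=> xs _; apply: leq_bigmax_seq.
case: (ex_maxnP (uniq_has_notin Us lt_ts) ub) => m /andP[ms mt] maxm.
by exists m; split=> // x xs xt; apply: maxm; rewrite xs.
Qed.

(** [S] may be any list containing the sums: inclusion is what lower bounds on [size S] use. *)
Definition restricted_sums_in A B S :=
  {in A & B, forall x y, x != y -> x + y \in S}.

Lemma restricted_sums_inC A B S :
  restricted_sums_in A B S -> restricted_sums_in B A S.
Proof. by move=> sub x y xB yA neq; rewrite addnC sub // eq_sym. Qed.

(* [a] is dropped from the second part since a + M already occurs in the first. *)
Definition hook a M A B :=
  [seq a + y | y <- B & y != a] ++ [seq x + M | x <- A & x \notin [:: a; M]].

Lemma mem_hook a M A B z : z \in hook a M A B ->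
  (exists2 y, y \in B & z = a + y) \/
  (exists x, [/\ x \in A, x != a & z = x + M]).
Proof.
rewrite mem_cat => /orP[] /mapP[y]; rewrite mem_filter => /andP[ya yB] ->.
  by left; exists y.
by right; exists y; split=> //; move: ya; rewrite !inE negb_or => /andP[].
Qed.

Lemma size_filter_predC1 s x :
  uniq s -> size [seq y <- s | y != x] + (x \in s) = size s.
Proof.
by move=> Us; rewrite size_filter -count_uniq_mem // addnC count_predC.
Qed.

Section Hook.
Variables (A B : seq nat) (a M : nat).
Hypotheses (UA : uniq A) (UB : uniq B) (aA : a \in A) (MB : M \in B).
Hypotheses (min_a : {in A, forall x, a <= x}) (max_M : {in B, forall y, y <= M}).

(** Both parts are injective images, and every x + M with x > a exceeds every a + y with y <= M. *)
Lemma hook_uniq : uniq (hook a M A B).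
Proof.
rewrite cat_uniq (map_inj_uniq (@addnI a)) (map_inj_uniq (@addIn M)).
rewrite !filter_uniq // andbT /=.
apply/hasPn => z /mapP[x]; rewrite mem_filter !inE => /andP[xa xA] ->.
apply/negP => /mapP[y]; rewrite mem_filter => /andP[ya yB].
by have := min_a xA; have := max_M yB; lia.
Qed.

Lemma hook_sub S : restricted_sums_in A B S -> {subset hook a M A B <= S}.
Proof.
move=> sub z; rewrite mem_cat => /orP[] /mapP[y]; rewrite mem_filter.
  by case/andP=> ya yB ->; apply: sub; rewrite // eq_sym.
by rewrite !inE negb_or => /andP[/andP[_ yM] yA] ->; apply: sub.
Qed.

(** The first part loses [a] if it lies in [B]; the second loses [a], and also [M] if it lies in
    [A]. When M = a the last loss is counted twice, hence an inequality. *)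
Lemma size_hook :
  size A + size B <= size (hook a M A B) + 1 + (a \in B) + (M \in A).
Proof.
rewrite size_cat !size_map.
have h1 := size_filter_predC1 a UB; have h2 := size_filter_predC1 a UA.
have h3 := size_filter_predC1 M (filter_uniq (fun y => y != a) UA).
have e : [seq x <- A | x \notin [:: a; M]] =
         [seq y <- [seq y <- A | y != a] | y != M].
  by rewrite -filter_predI; apply: eq_filter => x; rewrite !inE negb_or andbC.
rewrite e; move: h1 h2 h3; rewrite mem_filter aA.
by case: (M \in A); case: (M != a) => /=; lia.
Qed.

Lemma size_restricted_sums_hook S : restricted_sums_in A B S ->
  size A + size B <= size S + 1 + (a \in B) + (M \in A).
Proof.
move=> /hook_sub/(uniq_leq_size hook_uniq) le_S.
by apply: leq_trans size_hook _; rewrite !leq_add2r.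
Qed.

(** The sum x + a lies off the chain: x + a = a + y would put x = y in [B], and y + M > x + a once y
    > a and x <= M. *)
Lemma size_restricted_sums_notin S x : restricted_sums_in A B S ->
  a \in B -> {in A, forall y, y <= M} -> x \in A -> x \notin B ->
  size A + size B <= size S + 2.
Proof.
move=> sub aB maxA xA xB.
have xa : x != a by apply: contraNneq xB => ->.
have Uh : uniq (x + a :: hook a M A B).
  rewrite /= hook_uniq andbT; apply/negP => /mem_hook[[y yB]|[y [yA ya]]].
    by rewrite addnC => /addnI xy; rewrite xy yB in xB.
  by have := maxA _ xA; have := min_a yA; lia.
have le_S : (size (hook a M A B)).+1 <= size S.
  apply: (uniq_leq_size Uh) => z; rewrite inE => /predU1P[->|]; last exact: hook_sub.
  exact: sub.
by have := size_hook; lia.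
Qed.

End Hook.

(** * The lower bound, and equality of the two sets when it is attained *)

Lemma size_restricted_sums A B S : uniq A -> uniq B -> 0 < size A -> 0 < size B ->
  restricted_sums_in A B S -> size A + size B <= size S + 3.
Proof.
move=> UA UB A0 B0 sub.
have [a [aA _ min_a]] := uniq_min_notin (t := [::]) UA A0.
have [M [MB _ max_M]] := uniq_max_notin (t := [::]) UB B0.
have := size_restricted_sums_hook UA UB aA MB
  (fun x xA => min_a x xA isT) (fun x xB => max_M x xB isT) sub.
by lia.
Qed.

Lemma restricted_sums_tight_eq A B S : uniq A -> uniq B ->
  0 < size A -> 0 < size B -> restricted_sums_in A B S ->
  size S + 2 < size A + size B -> A =i B.
Proof.
move=> UA UB A0 B0 sub tight; have subC := restricted_sums_inC sub.
(* Under [tight], both membership terms of the chain bound must equal 1. *)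
have both_true (b1 b2 : bool) :
    size A + size B <= size S + 1 + b1 + b2 -> b1 && b2.
  by clear -tight; lia.
have [a [aA _ min_a]] := uniq_min_notin (t := [::]) UA A0.
have [M [MA _ max_M]] := uniq_max_notin (t := [::]) UA A0.
have [b [bB _ min_b]] := uniq_min_notin (t := [::]) UB B0.
have [N [NB _ max_N]] := uniq_max_notin (t := [::]) UB B0.
have {}min_a x (xA : x \in A) := min_a x xA isT.
have {}max_M x (xA : x \in A) := max_M x xA isT.
have {}min_b x (xB : x \in B) := min_b x xB isT.
have {}max_N x (xB : x \in B) := max_N x xB isT.
have /both_true/andP[aB NA] :=
  size_restricted_sums_hook UA UB aA NB min_a max_N sub.
have := size_restricted_sums_hook UB UA bB MA min_b max_M subC.
rewrite [size B + _]addnC => /both_true/andP[bA MB].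
have eab : b = a by apply/eqP; rewrite eqn_leq min_a ?min_b.
have eMN : N = M by apply/eqP; rewrite eqn_leq max_M ?max_N.
subst b N => x; apply/idP/idP => [xA|xB]; apply: contraLR tight => nx.
  by rewrite -leqNgt (size_restricted_sums_notin UA UB aA MB min_a max_N sub _ _ xA).
rewrite -leqNgt addnC.
by rewrite (size_restricted_sums_notin UB UA aB MA min_b max_M subC _ _ xB).
Qed.

(** * Structure of a set attaining the bound *)

Section Tight.
Variables (A S : seq nat).
Hypotheses (UA : uniq A) (A4 : 3 < size A) (sub : restricted_sums_in A A S).
Hypothesis tight : size S + 3 <= size A + size A.

(** The chain is duplicate-free, contained in [S] and at least as long as [S], so it has the same
    elements as [S]. *)
Lemma tight_sum_hook a M : a \in A -> M \in A ->
  {in A, forall x, a <= x} -> {in A, forall x, x <= M} ->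
  {in A &, forall x y, x != y ->
    (exists2 z, z \in A & x + y = a + z) \/
    (exists z, [/\ z \in A, z != a & x + y = z + M])}.
Proof.
move=> aA MA min_a max_M x y xA yA neq; apply: mem_hook.
have Uh := hook_uniq UA UA aA MA min_a max_M.
have size_le : size S <= size (hook a M A A).
  by have := size_hook UA UA aA MA; rewrite aA MA; lia.
have [_ ->] := uniq_min_size Uh (hook_sub aA MA sub) size_le.
exact: sub.
Qed.

Lemma tight_ends : exists a b N M,
  [/\ [/\ a \in A, b \in A, N \in A & M \in A],
      [/\ a < b, b < N, N < M & b + N = a + M],
      {in A, forall x, x = a \/ b <= x},
      {in A, forall x, x = M \/ x <= N} &
      {in A, forall x, b < x < N -> x + (b - a) \in A /\ x - (b - a) \in A}].
Proof.
have [a [aA _ min_a]] := uniq_min_notin (t := [::]) UA (ltac:(rewrite /=; lia)).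
have [M [MA _ max_M]] := uniq_max_notin (t := [::]) UA (ltac:(rewrite /=; lia)).
have {}min_a x (xA : x \in A) := min_a x xA isT.
have {}max_M x (xA : x \in A) := max_M x xA isT.
have [b [bA ba min_b]] := uniq_min_notin (t := [:: a]) UA (ltac:(rewrite /=; lia)).
have [N [NA NM max_N]] := uniq_max_notin (t := [:: M]) UA (ltac:(rewrite /=; lia)).
have {}min_b x : x \in A -> x = a \/ b <= x.
  by move=> xA; case: (eqVneq x a) => [|xa]; [left | right; apply: min_b; rewrite ?inE].
have {}max_N x : x \in A -> x = M \/ x <= N.
  by move=> xA; case: (eqVneq x M) => [|xM]; [left | right; apply: max_N; rewrite ?inE].
have ltab : a < b by have := min_a _ bA; move: ba; rewrite !inE; lia.
have ltNM : N < M by have := max_M _ NA; move: NM; rewrite !inE; lia.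
(* A fourth element separates the two ends: b < c <= N. *)
have [c /andP[cA]] := uniq_has_notin (t := [:: a; b; M]) UA A4.
rewrite !inE !negb_or => /and3P[ca cb cM].
have ltbN : b < N by have := max_N _ cA; have := min_b _ cA; lia.
have hook_sum := tight_sum_hook aA MA min_a max_M.
(* The form z + M is excluded: z >= b and x < M would give z + M > b + x. *)
have up x : x \in A -> b < x < M -> exists2 z, z \in A & b + x = a + z.
  move=> xA bxM; have neq : b != x by lia.
  have [//|[z [zA za e]]] := hook_sum b x bA xA neq.
  by have := min_b _ zA; clear -za e bxM; lia.
have down x : x \in A -> a < x < N -> exists2 z, z \in A & N + x = z + M.
  move=> xA axN; have neq : N != x by lia.
  have [[z zA e]|[z [zA _ e]]] := hook_sum N x NA xA neq; last by exists z.
  (* Since x > a, the equation N + x = a + z forces z > N, so z = M and [a] is the witness. *)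
  by exists a => //; have := max_N _ zA; clear -e axN; lia.
(* From b + N = a + z and a < b follows z > N, so z = M: the two end gaps are equal. *)
have [|z zA ez] := up N NA; first by lia.
have eM : b + N = a + M.
  by have := max_N _ zA; have := max_M _ zA; lia.
exists a, b, N, M; split=> // x xA bxN; split.
  have [|y yA ey] := up x xA; first by clear -bxN ltNM; lia.
  by have -> : x + (b - a) = y by clear -ey ltab; lia.
have [|y yA ey] := down x xA; first by clear -bxN ltab; lia.
by have -> : x - (b - a) = y by clear -ey eM bxN ltab; lia.
Qed.

(** With d the common end gap, every element other than M has its translate by d in [A]. So each
    element climbs to M in steps of d, as does the minimum a, which places it on the progression
    from a. *)
Lemma tight_arith_prog : 4 < size A ->
  exists a d n, 0 < n /\ A =i [seq a + i * d | i <- iota 0 n].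
Proof.
move=> A5; have [a [b [N [M [[aA bA NA MA] [ltab ltbN ltNM eM]]]]]] := tight_ends.
move=> min_b max_N mid; set d := b - a in mid *.
have [c [cA cab min_c]] := uniq_min_notin (t := [:: a; b]) UA (ltac:(rewrite /=; lia)).
(* A fifth element e < N forces the third smallest element c below N, where [mid] applies. *)
have [e /andP[eA]] := uniq_has_notin (t := [:: a; b; N; M]) UA A5.
rewrite !inE !negb_or => /and4P[ea eb eN eM'].
have lec : c <= e by apply: min_c; rewrite // !inE; lia.
have ltbc : b < c.
  by move: cab; rewrite !inE negb_or => /andP[ca cb]; have := min_b _ cA; lia.
(* The element c - d of [A] is below c, so it is a or b; c - d = a would mean c = b. *)
have ec : c = b + d.
  have ltcN : c < N by have := max_N _ eA; lia.
  have [_ cdA] := mid c cA (ltac:(lia)).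
  case: (eqVneq (c - d) a) => [|cda]; first by rewrite /d; lia.
  case: (eqVneq (c - d) b) => [|cdb]; first by rewrite /d; lia.
  by have := min_c _ cdA; rewrite !inE negb_or cda cdb; rewrite /d; lia.
have step x : x \in A -> x != M -> x + d \in A.
  move=> xA xM; case: (eqVneq x a) => [->|xa]; first by have -> : a + d = b by rewrite /d; lia.
  case: (eqVneq x b) => [->|xb]; first by rewrite -ec.
  case: (eqVneq x N) => [->|xN]; first by have -> : N + d = M by rewrite /d; lia.
  by have [] // := mid x xA; have := min_b _ xA; have := max_N _ xA; lia.
have reach k x : x \in A -> M - x <= k ->
    exists j, x + j * d = M /\ forall i, i <= j -> x + i * d \in A.
  elim: k x => [|k IHk] x xA lek.
    by exists 0; split=> [|i]; [have := max_N _ xA; lia|rewrite leqn0 => /eqP->; rewrite addn0].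
  case: (eqVneq x M) => [->|xM].
    by exists 0; split=> [|i]; [lia|rewrite leqn0 => /eqP->; rewrite addn0].
  have [|j [ej subj]] := IHk _ (step x xA xM); first by rewrite /d; lia.
  exists j.+1; split=> [|[|i] lei]; [by lia|by rewrite addn0|].
  by have -> : x + i.+1 * d = x + d + i * d by [lia]; apply: subj.
have [J [eJ subJ]] := reach _ a aA (leqnn _).
exists a, d, J.+1; split=> // x; apply/idP/mapP => [xA|[i]]; last first.
  by rewrite mem_iota => ltiJ ->; apply: subJ.
have [j [ej _]] := reach _ x xA (leqnn _).
have d0 : 0 < d by rewrite /d; lia.
have lejJ : j <= J.
  rewrite -(leq_pmul2r d0); have := min_b _ xA; lia.
(* From x + j * d = M = a + J * d one gets x = a + (J - j) * d. *)
exists (J - j); first by rewrite mem_iota; lia.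
by rewrite mulnBl; have : j * d <= J * d by [rewrite leq_pmul2r]; lia.
Qed.

End Tight.
End NatSeq.

(** * Residues and their representatives *)

Section Residues.
Variable p : nat.
Hypothesis p_prime : prime p.
Implicit Types A B : {set 'F_p}.

Definition reprs A : seq nat := [seq nat_of_ord x | x <- enum A].

Lemma reprs_uniq A : uniq (reprs A).
Proof. by rewrite map_inj_uniq ?enum_uniq //; apply: val_inj. Qed.

Lemma size_reprs A : size (reprs A) = #|A|.
Proof. by rewrite size_map -cardE. Qed.

Lemma mem_reprs A (x : 'F_p) : ((x : nat) \in reprs A) = (x \in A).
Proof. by rewrite mem_map ?mem_enum //; apply: val_inj. Qed.

Lemma reprsP A (k : nat) : reflect (exists2 x : 'F_p, x \in A & k = x) (k \in reprs A).
Proof.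
by apply: (iffP mapP) => [] [x xA ->]; exists x => //; rewrite mem_enum in xA *.
Qed.

Lemma Fp_addE (x y : 'F_p) : (x + y < p)%N -> (x + y)%R = (x + y)%N :> nat.
Proof.
by move=> lt_p; rewrite /= modn_small //; apply: leq_trans lt_p _; rewrite Fp_cast.
Qed.

Lemma max_repr_lt A B : (max_repr A + max_repr B < p)%N ->
  {in A & B, forall x y : 'F_p, x + y < p}%N.
Proof.
move=> lt_p x y xA yB; apply: leq_ltn_trans lt_p.
by apply: leq_add; apply: (@leq_bigmax_cond _ _ (fun z : 'F_p => z : nat)).
Qed.

Lemma restricted_sumset_reprs A B : (max_repr A + max_repr B < p)%N ->
  restricted_sums_in (reprs A) (reprs B) (reprs (restricted_sumset A B)).
Proof.
move=> lt_p _ _ /reprsP[x xA ->] /reprsP[y yB ->] neq.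
rewrite -Fp_addE ?(max_repr_lt lt_p) // mem_reprs.
by apply/imset2P; exists x y; rewrite ?inE ?yB.
Qed.

(** * Upper bounds for the listed families *)

(** A restricted sum depends only on the unordered pair; for 2 and 3 elements the binomial equals 2
    * #|A| - 3. *)
Lemma card_restricted_sumset_bin A : (#|restricted_sumset A A| <= 'C(#|A|, 2))%N.
Proof.
rewrite -cards_draws; set P := finset _.
apply: leq_trans (leq_imset_card (fun X : {set 'F_p} => \sum_(x in X) x) P).
apply/subset_leq_card/subsetP => _ /imset2P[x y xA /[!inE]/andP[yA neq] ->].
apply/imsetP; exists [set x; y]; last by rewrite big_setU1 ?inE // big_set1.
by rewrite !inE cards2 neq subUset !sub1set xA yA.
Qed.

(** Of the six pairs, two share a sum: a + (c + d) = (a + d) + c. *)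
Lemma card_restricted_sumset_pairs (a c d : 'F_p)
  (A := [set a; a + d; c; c + d]) : (#|restricted_sumset A A| <= 5)%N.
Proof.
pose s := [:: a + a + d; a + c; a + c + d; a + c + d + d; c + c + d].
apply: leq_trans (card_size s).
apply/subset_leq_card/subsetP => _ /imset2P[x y xA /[!inE]/andP[yA neq] ->].
move: xA yA neq; rewrite !inE.
move=> /orP[/orP[/orP[]|]|] /eqP-> /orP[/orP[/orP[]|]|] /eqP->; rewrite ?eqxx ?orbT // => _;
  do ?[by apply/orP; left; apply/eqP; ring | apply/orP; right]; apply/eqP; ring.
Qed.

Lemma mulrn_Fp_inj (d : 'F_p) (i j : nat) :
  d != 0 -> (i < p)%N -> (j < p)%N -> d *+ i = d *+ j -> i = j.
Proof.
move=> d0 ltip ltjp; wlog leij : i j ltip ltjp / (i <= j)%N => [wl e|/eqP].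
  by case/orP: (leq_total i j) => /wl; [apply|move/(_ ltjp ltip (esym e))].
rewrite eq_sym -subr_eq0 -mulrnBr // -mulr_natr mulf_eq0 (negPf d0) /=.
rewrite -(dvdn_pcharf (pchar_Fp p_prime)) => dvd_p.
by case: (posnP (j - i)) => [|/dvdn_leq/(_ dvd_p)]; lia.
Qed.

(** The given length may exceed #|A| by wrapping. But d is nonzero, so the first p terms are
    distinct: a length above p would fill the field, and a length up to p equals #|A|. *)
Lemma arith_prog_card A : (2 <= #|A|)%N -> (#|A| < p)%N -> is_arith_prog A ->
  exists a d : 'F_p, A = [set a + d *+ i | i : 'I_#|A|].
Proof.
move=> A2 ltAp [a [d [n eA]]]; exists a, d.
have d0 : d != 0.
  apply: contraTneq A2 => d0; rewrite -ltnNge ltnS -(cards1 a).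
  apply/subset_leq_card/subsetP => x; rewrite eA => /imsetP[i _ ->].
  by rewrite d0 mul0rn addr0 inE.
have inj m (f := fun i : 'I_m => a + d *+ i) : (m <= p)%N -> injective f.
  move=> lemp i j /addrI/(mulrn_Fp_inj d0) e; apply: val_inj; apply: e.
    exact: leq_trans lemp.
  exact: leq_trans lemp.
case: (leqP n p) => [lenp|ltpn]; last first.
  have : (p <= #|A|)%N.
    rewrite -[p in (p <= _)%N]card_ord -(card_imset _ (inj p (leqnn p))).
    apply/subset_leq_card/subsetP => _ /imsetP[i _ ->]; rewrite eA.
    by apply/imsetP; exists (widen_ord (ltnW ltpn) i).
  by rewrite leqNgt ltAp.
have -> : #|A| = n by rewrite eA card_imset ?card_ord //; apply: inj.
exact: eA.
Qed.

(** Distinct indices satisfy 1 <= i + j <= 2 * n - 3, whence the shift [k.+1] in [f]. *)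
Lemma card_restricted_sumset_ap (a d : 'F_p) (n : nat)
  (A := [set a + d *+ i | i : 'I_n]) :
  (#|restricted_sumset A A| <= 2 * n - 3)%N.
Proof.
pose f (k : 'I_(2 * n - 3)) := a + a + d *+ k.+1.
rewrite -[leqRHS]card_ord; apply: leq_trans (leq_imset_card f _).
apply/subset_leq_card/subsetP => _ /imset2P[_ _ /imsetP[i _ ->] /[!inE]/andP[/imsetP[j _ ->] neq] ->].
have neij : (i : nat) != j by apply: contraNneq neq => ->.
have lt_ij : ((i + j).-1 < 2 * n - 3)%N by have := ltn_ord i; have := ltn_ord j; lia.
apply/imsetP; exists (Ordinal lt_ij) => //; rewrite /f /=.
have -> : (i + j).-1.+1 = (i + j)%N by lia.
by rewrite mulrnDr; ring.
Qed.

(** * Transfer of the results on natural numbers to residues *)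

Section NoWrap.
Variables A B : {set 'F_p}.
Hypotheses (A0 : (0 < #|A|)%N) (B0 : (0 < #|B|)%N).
Hypothesis max_lt : (max_repr A + max_repr B < p)%N.

Lemma card_restricted_sumset_ge : (#|A| + #|B| <= #|restricted_sumset A B| + 3)%N.
Proof.
have := size_restricted_sums (reprs_uniq A) (reprs_uniq B).
by rewrite !size_reprs => /(_ _ A0 B0 (restricted_sumset_reprs max_lt)); rewrite size_reprs.
Qed.

Lemma restricted_sumset_tight_eq :
  (#|restricted_sumset A B| + 2 < #|A| + #|B|)%N -> A = B.
Proof.
move=> tight; apply/setP => x; rewrite -!mem_reprs; move: (x : nat).
by apply: restricted_sums_tight_eq (restricted_sumset_reprs max_lt) _;
  rewrite ?reprs_uniq ?size_reprs.
Qed.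

End NoWrap.

Section SelfSum.
Variable A : {set 'F_p}.
Hypotheses (A4 : (3 < #|A|)%N) (max_lt : (max_repr A + max_repr A < p)%N).
Hypothesis tight : (#|restricted_sumset A A| + 3 <= #|A| + #|A|)%N.

Lemma restricted_sumset_tight_pairs :
  #|A| = 4%N -> exists a c d : 'F_p, A = [set a; a + d; c; c + d].
Proof.
move=> card4; have [] := tight_ends (reprs_uniq A) _ (restricted_sumset_reprs max_lt).
- by rewrite size_reprs.
- by rewrite !size_reprs.
move=> _ [_ [_ [_ [[/reprsP[a aA ->] /reprsP[b bA ->] /reprsP[c cA ->] /reprsP[d dA ->]]]]]].
(* The four elements a < b < c < d satisfy b + c = a + d, so b - a is also d - c. *)
move=> [ltab ltbc ltcd e] _ _ _; exists a, c, (b - a).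
have eb : a + (b - a) = b by ring.
have ed : c + (b - a) = d.
  have : (b + c)%N%:R = (a + d)%N%:R :> 'F_p by rewrite e.
  by rewrite !natrD !natr_Zp => h; rewrite -[RHS](addKr a) -h; ring.
rewrite eb ed; apply/esym/eqP; rewrite eqEcard card4; apply/andP; split.
  by apply/subsetP => x; rewrite !inE => /orP[/orP[/orP[]|]|] /eqP->.
rewrite -!setUA !cardsU1 cards1 !inE -!val_eqE /=.
by lia.
Qed.

Lemma restricted_sumset_tight_arith_prog : (4 < #|A|)%N -> is_arith_prog A.
Proof.
move=> A5; have [] := tight_arith_prog (reprs_uniq A) _ (restricted_sumset_reprs max_lt).
- by rewrite size_reprs.
- by rewrite !size_reprs.
- by rewrite size_reprs.
move=> a [d [n [_ eA]]]; exists a%:R, d%:R, n.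
have cast i : a%:R + d%:R *+ i = (a + i * d)%N%:R :> 'F_p.
  by rewrite natrD natrM mulr_natl.
apply/setP => x; apply/idP/imsetP => [|[i _ ->]].
  rewrite -mem_reprs eA => /mapP[i]; rewrite mem_iota /= => lti ex.
  by exists (Ordinal lti) => //; rewrite cast -ex natr_Zp.
have : (a + i * d)%N \in reprs A.
  by rewrite eA; apply/mapP; exists (i : nat); rewrite ?mem_iota /=.
by case/reprsP=> y yA ey; rewrite cast ey natr_Zp.
Qed.

End SelfSum.
End Residues.

Theorem theorem5 (p : nat) (p_prime : prime p) (A B : {set 'F_p})
  (cardA : (2 <= #|A|)%N) (cardB : (2 <= #|B|)%N)
  (p_large : (#|A| + #|B| - 2 <= p)%N)
  (max_lt : (max_repr A + max_repr B < p)%N) :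
  #|restricted_sumset A B| = (#|A| + #|B| - 3)%N <->
  A = B /\
  [\/ #|A| = 2%N \/ #|A| = 3%N,
      #|A| = 4%N /\ exists a c d : 'F_p, A = [set a; a + d; c; c + d]
    | (5 <= #|A|)%N /\ is_arith_prog A].
Proof.
have A0 := ltnW cardA; have B0 := ltnW cardB.
split=> [cardAB|[eAB cases]].
  have eAB : A = B.
    by apply: (restricted_sumset_tight_eq p_prime A0 B0 max_lt); rewrite cardAB; lia.
  subst B; split=> //.
  have tight : (#|restricted_sumset A A| + 3 <= #|A| + #|A|)%N.
    by rewrite cardAB; lia.
  have [|A4] := leqP #|A| 3; first by move=> A3; apply: Or31; lia.
  have [|A5] := leqP #|A| 4; last first.
    by apply: Or33; split=> //; apply: restricted_sumset_tight_arith_prog tight _.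
  move=> A4'; have card4 : #|A| = 4%N by lia.
  by apply: Or32; split=> //; apply: restricted_sumset_tight_pairs tight _.
subst B; have ge := card_restricted_sumset_ge p_prime A0 B0 max_lt.
(* The lower bound is general, so only the upper bound depends on the case. *)
suff le : (#|restricted_sumset A A| <= #|A| + #|A| - 3)%N by lia.
case: cases => [[cA|cA]|[cA [a [c [d eA]]]]|[cA apA]].
- by have := card_restricted_sumset_bin A; rewrite cA.
- by have := card_restricted_sumset_bin A; rewrite cA.
- by rewrite cA eA card_restricted_sumset_pairs.
(* [p_large] reads 2 * #|A| - 2 <= p, which exceeds #|A| when #|A| >= 5. *)
have ltAp : (#|A| < p)%N by lia.
have [a [d eA]] := arith_prog_card p_prime cardA ltAp apA.
by rewrite {1 2}eA addnn -mul2n card_restricted_sumset_ap.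
Qed.
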